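(* Let $G$ be a totally disconnected locally compact group, $\phi:G\to G$ a topological automorphism and $k$ a positive integer. Then $h_{top}(\phi^k)=k\cdot h_{top}(\phi)$.
   Context: For a totally disconnected locally compact group $G$, $\mathcal B(G)$ denotes the family of all open compact subgroups of $G$. A topological automorphism is a group automorphism that is a homeomorphism. For a continuous endomorphism $\psi:G\to G$, $U\in\mathcal B(G)$ and an integer $n\ge 1$, put $C_n(\psi,U)=U\cap\psi^{-1}(U)\cap\ldots\cap\psi^{-n+1}(U)$; the index $[U:C_n(\psi,U)]$ is finite. The topological entropy of $\psi$ with respect to $U$ is $H_{top}(\psi,U)=\lim_{n\to\infty}\frac{\log[U:C_n(\psi,U)]}{n}$ (the limit exists), and the topological entropy of $\psi$ is $h_{top}(\psi)=\sup\{H_{top}(\psi,U):U\in\mathcal B(G)\}\in[0,\infty]$, with the convention $k\cdot\infty=\infty$ for $k\ge 1$. *)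

(* Defs.v *)
From HB Require Import structures.
From mathcomp Require Import all_boot all_order all_algebra.
From mathcomp Require Import finmap.
From mathcomp Require Import all_classical all_reals.
From mathcomp Require Import ereal topology normedtype sequences exp.

Set Implicit Arguments.
Unset Strict Implicit.
Unset Printing Implicit Defensive.
Import Order.TTheory GRing.Theory Num.Theory.
Import numFieldNormedType.Exports.

Local Open Scope classical_set_scope.

(* No separation axiom is included: a totally disconnected topological group
   is automatically Hausdorff, since the closure of 1 is connected. *)
HB.mixin Record Topological_isTopologicalGroup G
    of Group G & Topological G := {
  mulg_continuous : continuous (fun z : G * G => z.1 * z.2)%g;
  invg_continuous : continuous (fun x : G => x^-1)%g
}.

#[short(type="topologicalGroupType")]
HB.structure Definition TopologicalGroup :=
  {G of Topological_isTopologicalGroup G & Group G & Topological G}.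

Definition homeomorphism (S T : topologicalType) (f : S -> T) :=
  continuous f /\
  exists g : T -> S, [/\ cancel f g, cancel g f & continuous g].

Section Entropy.
Variables (R : realType) (G : topologicalGroupType).
Implicit Types (U C : set G) (psi : G -> G).

Definition topological_automorphism psi :=
  {morph psi : x y / (x * y)%g} /\ homeomorphism psi.

Definition open_compact_subgroups : set (set G) :=
  [set U : set G | [/\ group_closed (mem U), open U & compact U]].

Definition left_cosets U C : set (set G) :=
  [set [set (x * c)%g | c in C] | x in U].

(* [U : C]. As [fset_set] sends infinite sets to [fset0], the value is 0 when
   the index is infinite; this does not occur for an open subgroup C of a
   compact group U. *)
Definition subgroup_index U C : nat := #|` fset_set (left_cosets U C)|.

Definition C_ psi U (n : nat) : set G :=
  \bigcap_(i < n) (iter i psi @^-1` U).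

(* [psi] is meant to be a continuous endomorphism; the limit then exists for
   every U in B(G). The term n = 0 is irrelevant to the limit. *)
Definition H_top psi U : R :=
  limn (fun n : nat => ln (subgroup_index U (C_ psi U n))%:R / n%:R)%R.

Definition h_top psi : \bar R :=
  ereal_sup [set (H_top psi U)%:E | U in open_compact_subgroups].

End Entropy.

(* Main.v *)
Require Import Defs.
From HB Require Import structures.
From mathcomp Require Import all_boot all_order all_algebra.
From mathcomp Require Import finmap.
From mathcomp Require Import all_classical all_reals.
From mathcomp Require Import ereal topology normedtype sequences exp.

Local Open Scope classical_set_scope.
Local Open Scope ereal_scope.

(** Let psi be a continuous endomorphism of G. The idea is that the
psi^k-trajectory of a suitable open compact subgroup is a psi-trajectory sampled
every k steps. Fix U in B(G), and write C_n for C_n(psi, U).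

The limit defining H_top(psi, U) has to be shown to exist, because limn has a
junk value otherwise. Let n >= 1. Indices are multiplicative
([subgroup_index_mul]), so log [U : C_(n+1)] - log [U : C_n] =
log [C_n : C_(n+1)]. These increments are nonincreasing in n
([subgroup_index_C_step]): psi maps C_(n+1) into C_n, and C_(n+2) is the
part of C_(n+1) that psi sends into C_(n+1), so psi induces
an injection of C_(n+1)/C_(n+2) into C_n/C_(n+1). Being nonnegative,
they converge, and by Cesaro's theorem log [U : C_n] / n converges to the same
limit ([cvg_H_top]). Consequently log [U : C_(nk)] / n tends to
k H_top(psi, U) ([cvg_H_top_mul]), and both inequalities are read off from this
limit.

- C_(nk) is contained in C_n(psi^k, U), hence
  H_top(psi^k, U) <= k H_top(psi, U) ([H_top_iter_le]).
- V := C_k is again in B(G), and C_n(psi^k, V) = C_(nk) exactly ([C_iter]).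
  Since [V : C_(nk)] differs from [U : C_(nk)] by the constant factor [U : V],
  which disappears after taking logarithms and dividing by n,
  H_top(psi^k, V) = k H_top(psi, U) ([H_top_iter_C]).

Taking suprema over U gives the theorem. *)

Set Implicit Arguments.
Unset Strict Implicit.
Import Order.TTheory GRing.Theory Num.Theory.
Import numFieldNormedType.Exports.

Local Notation subgroup U := (group_closed (mem U)).
Local Notation coset x C := [set (x * c)%g | c in C].

(** * Cardinals of finite sets *)

Lemma card_fset_setX (T T' : choiceType) (A : set T) (B : set T') :
  finite_set A -> finite_set B ->
  #|` fset_set (A `*` B)| = (#|` fset_set A| * #|` fset_set B|)%N.
Proof.
move=> finA finB; rewrite fset_setX//.
rewrite -(size_allpairs pair (fset_set A) (fset_set B)).
apply/perm_size/uniq_perm => //.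
  by apply: allpairs_uniq => // -[? ?] [? ?].
move=> [x y]; rewrite in_fsetM/=.
by apply/idP/allpairsP => [/andP[xA yB]|[[? ?] [? ? [-> ->]]]];
  [exists (x, y)|apply/andP].
Qed.

Lemma leq_card_fset_set_inj (T T' : choiceType) (f : T -> T')
    (A : set T) (B : set T') :
  finite_set A -> finite_set B -> set_inj A f -> f @` A `<=` B ->
  (#|` fset_set A| <= #|` fset_set B|)%N.
Proof.
move=> finA finB f_inj fAB.
have finfA : finite_set (f @` A) by exact: finite_image.
have <- : #|` fset_set (f @` A)| = #|` fset_set A|.
  rewrite fset_set_image// card_in_imfset//= => x y.
  by rewrite !in_fset_set// => xA yA; exact: f_inj.
by rewrite fsubset_leq_card// -fset_set_sub.
Qed.

(** * Subgroups and their cosets *)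

Section Subgroups.
Variable G : groupType.
Implicit Types (U V C : set G) (x y : G) (psi : G -> G).

Lemma subgroup1 U : subgroup U -> U 1%g.
Proof. by move=> [/set_mem]. Qed.

Lemma subgroupM U x y : subgroup U -> U x -> U y -> U (x * y)%g.
Proof.
by move=> /group_closedM UM /mem_set Ux /mem_set Uy; exact/set_mem/UM.
Qed.

Lemma subgroupV U x : subgroup U -> U x -> U x^-1%g.
Proof. by move=> /group_closedV UV /mem_set Ux; exact/set_mem/UV. Qed.

Lemma subgroup_intro U : U 1%g ->
  (forall x y, U x -> U y -> U (x * y^-1)%g) -> subgroup U.
Proof.
by move=> U1 UB; split=> [|x y /set_mem Ux /set_mem Uy]; apply/mem_set => //;
  exact: UB.
Qed.

Lemma subgroup_preimage psi U : {morph psi : x y / (x * y)%g} ->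
  subgroup U -> subgroup (psi @^-1` U).
Proof.
move=> psiM Ugrp; have psi1 : psi 1%g = 1%g.
  by apply: (mulgI (psi 1%g)); rewrite -psiM !mulg1.
have psiV x : psi x^-1%g = (psi x)^-1%g.
  by apply: (mulgI (psi x)); rewrite -psiM !mulgV.
apply: subgroup_intro => [|x y Ux Uy] /=; first by rewrite psi1; exact: subgroup1.
by rewrite psiM psiV; exact: subgroupM Ugrp Ux (subgroupV Ugrp Uy).
Qed.

Lemma subgroupI U V : subgroup U -> subgroup V -> subgroup (U `&` V).
Proof.
move=> Ugrp Vgrp; apply: subgroup_intro => [|x y [Ux Vx] [Uy Vy]].
  by split; exact: subgroup1.
by split; [exact: subgroupM Ugrp Ux (subgroupV Ugrp Uy)|
           exact: subgroupM Vgrp Vx (subgroupV Vgrp Vy)].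
Qed.

Lemma coset_preimage U x : coset x U = (fun y => x^-1 * y)%g @^-1` U.
Proof.
apply/seteqP; split=> [_ [u Uu <-]|y Uy]/=; first by rewrite mulKg.
by exists (x^-1 * y)%g => //; rewrite mulVKg.
Qed.

Lemma eq_coset C x y : subgroup C -> C (x^-1 * y)%g -> coset x C = coset y C.
Proof.
move=> Cgrp Cxy; rewrite !coset_preimage; apply/seteqP; split=> z/= Cz.
  have -> : (y^-1 * z = (x^-1 * y)^-1 * (x^-1 * z))%g.
    by rewrite invgM invgK -mulgA mulVKg.
  exact: subgroupM (subgroupV Cgrp Cxy) Cz.
have -> : (x^-1 * z = (x^-1 * y) * (y^-1 * z))%g by rewrite -mulgA mulVKg.
exact: subgroupM Cgrp Cxy Cz.
Qed.

Lemma coset_eq C x y : subgroup C -> coset x C = coset y C -> C (x^-1 * y)%g.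
Proof.
move=> Cgrp xy; have : coset y C y.
  by exists 1%g; [exact: subgroup1|rewrite mulg1].
by rewrite -xy coset_preimage.
Qed.

End Subgroups.

(** * The index of a subgroup *)

Section Index.
Variable G : topologicalGroupType.
Implicit Types (U V C D : set G) (x y : G) (S T : set G).

Definition coset_repr S : G := xget 1%g S.

(** A coset is a bare set, without a base point. A chosen one is in U because the
coset x C is, and any point of x C generates the same coset. *)
Lemma coset_reprP U C S : subgroup U -> subgroup C -> C `<=` U ->
  left_cosets U C S -> U (coset_repr S) /\ S = coset (coset_repr S) C.
Proof.
move=> Ugrp Cgrp CU [x Ux xCS].
have : S (coset_repr S).
  rewrite /coset_repr; case: xgetP => // /(_ x) []; rewrite -xCS.
  by exists 1%g; [exact: subgroup1|rewrite mulg1].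
rewrite -xCS => -[c Cc <-]; split; first exact: subgroupM Ugrp Ux (CU _ Cc).
by apply: eq_coset => //; rewrite mulKg.
Qed.

Lemma left_translation_continuous x : continuous (fun y : G => x * y)%g.
Proof.
move=> y; have xyE := @mulg_continuous G (x, y).
apply: (cvg_comp (fun z => (x, z)) (fun p : G * G => p.1 * p.2)%g _ xyE).
exact: cvg_pair (cvg_cst _) cvg_id.
Qed.

Lemma open_coset U x : open U -> open (coset x U).
Proof.
move=> oU; rewrite coset_preimage; apply: open_comp => // y _.
exact: left_translation_continuous.
Qed.

(** The complement is a union of cosets, which are open. *)
Lemma open_subgroup_closed U : subgroup U -> open U -> closed U.
Proof.
move=> Ugrp oU; rewrite -[U]setCK; apply: open_closedC.
have -> : ~` U = \bigcup_(x in ~` U) coset x U.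
  apply/seteqP; split=> [x nUx|y [x nUx [u Uu <-]]].
    by exists x => //; exists 1%g; [exact: subgroup1|rewrite mulg1].
  move=> Uxu; apply: nUx; rewrite -(mulgK u x).
  exact: subgroupM Ugrp Uxu (subgroupV Ugrp Uu).
by apply: bigcup_open => x _; exact: open_coset.
Qed.

(** The cosets of C are open and any two of them are equal or disjoint, so a
finite family of them that covers U contains every coset of a point of U. *)
Lemma finite_left_cosets U C : compact U -> subgroup C -> open C ->
  finite_set (left_cosets U C).
Proof.
(* The base point 1 makes G a pointed space, to which [compact_cover] applies. *)
pose G1 : ptopologicalType := HB.pack G (isPointed.Build G 1%g).
move=> cU Cgrp oC; have : @cover_compact G1 U by rewrite -compact_cover.
move=> /(_ G U (fun x => coset x C))[|x Ux|F FU UF].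
- by move=> x _; exact: open_coset.
- by exists x => //; exists 1%g; [exact: subgroup1|rewrite mulg1].
apply: (@sub_finite_set _ _ ((fun x => coset x C) @` [set` F])); last first.
  exact/finite_image/finite_fset.
move=> _ [x Ux <-]; have [y yF [c Cc yc]] := UF x Ux.
by exists y => //; apply: eq_coset => //; rewrite -yc mulKg.
Qed.

Lemma subgroup_index_gt0 U C : subgroup U -> finite_set (left_cosets U C) ->
  (0 < subgroup_index U C)%N.
Proof.
move=> Ugrp fin; rewrite /subgroup_index cardfs_gt0; apply/fset0Pn.
exists (coset 1%g C); rewrite in_fset_set//; apply/mem_set.
by exists 1%g => //; exact: subgroup1.
Qed.

(** C_0 is the whole group, so this evaluates the first term of the sequence
[U : C_n]. *)
Lemma subgroup_indexT U : subgroup U -> subgroup_index U setT = 1%N.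
Proof.
move=> Ugrp; rewrite /subgroup_index.
suff -> : left_cosets U setT = [set setT] by rewrite fset_set1 cardfs1.
have cosetT x : coset x [set: G] = setT by rewrite coset_preimage preimage_setT.
apply/seteqP; split=> [_ [x _ <-]|_ ->]; first exact: cosetT.
by exists 1%g; [exact: subgroup1|exact: cosetT].
Qed.

Lemma left_cosets_sub U V C : V `<=` U -> left_cosets V C `<=` left_cosets U C.
Proof. by move=> VU _ [x Vx <-]; exists x => //; exact: VU. Qed.

Lemma finite_left_cosetsS U V C : subgroup U -> subgroup V -> subgroup C ->
  C `<=` V -> V `<=` U ->
  finite_set (left_cosets U C) -> finite_set (left_cosets U V).
Proof.
move=> Ugrp Vgrp Cgrp CV VU /(finite_image (fun S => coset (coset_repr S) V)).
apply: sub_finite_set => _ [x Ux <-]; exists (coset x C); first by exists x.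
have [|_ /coset_eq xC] := coset_reprP Ugrp Cgrp (subset_trans CV VU) (S := coset x C).
  by exists x.
by apply/esym/(eq_coset Vgrp)/CV/xC.
Qed.

(** Once a representative s is fixed in each coset of V in U, every coset of C
in U is s T for exactly one s and one coset T of C in V. *)
Lemma subgroup_index_mul U V C :
  subgroup U -> subgroup V -> subgroup C -> C `<=` V -> V `<=` U ->
  finite_set (left_cosets U C) ->
  subgroup_index U C = (subgroup_index U V * subgroup_index V C)%N.
Proof.
move=> Ugrp Vgrp Cgrp CV VU finUC.
have finUV := finite_left_cosetsS Ugrp Vgrp Cgrp CV VU finUC.
have finVC := sub_finite_set (left_cosets_sub VU) finUC.
have UVP := coset_reprP Ugrp Vgrp VU; have VCP := coset_reprP Vgrp Cgrp CV.
pose f (ST : set G * set G) := coset (coset_repr ST.1 * coset_repr ST.2)%g C.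
rewrite /subgroup_index -card_fset_setX//.
have <- : f @` (left_cosets U V `*` left_cosets V C) = left_cosets U C.
  apply/seteqP; split=> [_ [[S T] [/UVP[US _] /VCP[VT _]] <-]|_ [x Ux <-]].
    by exists (coset_repr S * coset_repr T)%g => //; exact: subgroupM Ugrp US (VU _ VT).
  have xV : left_cosets U V (coset x V) by exists x.
  have [_ /esym/(coset_eq Vgrp) Vsx] := UVP _ xV.
  set s := coset_repr _ in Vsx.
  have yC : left_cosets V C (coset (s^-1 * x)%g C) by exists (s^-1 * x)%g.
  have [_ /esym/(coset_eq Cgrp)] := VCP _ yC; set t := coset_repr _ => Ctx.
  exists (coset x V, coset (s^-1 * x)%g C) => //.
  by apply: eq_coset => //; rewrite invgM -mulgA.
rewrite fset_set_image; last exact: finite_setX.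
rewrite card_in_imfset//= => -[S T] [S' T'].
rewrite !in_fset_set; do ?[exact: finite_setX].
move=> /set_mem[/= /UVP[_ defS] /VCP[VT defT]].
move=> /set_mem[/= /UVP[_ defS'] /VCP[VT' defT']].
rewrite /f/= => /(coset_eq Cgrp) Cst.
have eqS : S = S'.
  rewrite defS defS'; apply: (eq_coset Vgrp).
  rewrite invgM -!mulgA in Cst.
  have := subgroupM Vgrp (subgroupM Vgrp VT (CV _ Cst)) (subgroupV Vgrp VT').
  by rewrite mulVKg !mulgA mulgK.
congr (_, _) => //; rewrite defT defT'; apply: (eq_coset Cgrp).
by move: Cst; rewrite eqS invgM -mulgA mulKg.
Qed.

Lemma subgroup_index_antitone U V C :
  subgroup U -> subgroup V -> subgroup C -> C `<=` V -> V `<=` U ->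
  finite_set (left_cosets U C) ->
  (subgroup_index U V <= subgroup_index U C)%N.
Proof.
move=> Ugrp Vgrp Cgrp CV VU fin; rewrite (subgroup_index_mul Ugrp Vgrp Cgrp)//.
rewrite leq_pmulr// subgroup_index_gt0//.
exact: sub_finite_set (left_cosets_sub VU) fin.
Qed.

(** The map x (U `&` f^-1 D) |-> f(x) D from cosets in U to cosets in V is
injective: if f(x) and f(y) are in the same coset of D, then f(x^-1 y) is in D.
A representative x of each coset is chosen to define the map. *)
Lemma subgroup_index_preimage (f : G -> G) U V D :
  {morph f : x y / (x * y)%g} -> subgroup U -> subgroup V -> subgroup D ->
  D `<=` V -> U `<=` f @^-1` V ->
  subgroup (U `&` f @^-1` D) ->
  finite_set (left_cosets U (U `&` f @^-1` D)) ->
  finite_set (left_cosets V D) ->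
  (subgroup_index U (U `&` f @^-1` D) <= subgroup_index V D)%N.
Proof.
move=> fM Ugrp Vgrp Dgrp DV UfV Cgrp finU finV.
have UCP := coset_reprP Ugrp Cgrp (@subIsetl _ _ _).
apply: (@leq_card_fset_set_inj _ _ (fun S => coset (f (coset_repr S)) D)) => //.
  move=> S T /set_mem/UCP[US defS] /set_mem/UCP[UT defT] /(coset_eq Dgrp) Df.
  rewrite defS defT; apply: (eq_coset Cgrp); split.
    exact: subgroupM Ugrp (subgroupV Ugrp US) UT.
  have := fM (coset_repr S) ((coset_repr S)^-1 * coset_repr T)%g.
  by rewrite mulVKg /= => fT; move: Df; rewrite fT mulKg.
by move=> _ [S /UCP[US _] <-]; exists (f (coset_repr S)) => //; exact: UfV.
Qed.

End Index.

(** * Trajectories of an open compact subgroup *)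

Section Trajectories.
Variable G : topologicalGroupType.
Implicit Types (U : set G) (psi : G -> G) (n k : nat).

Lemma C_0 psi U : C_ psi U 0 = setT.
Proof. by apply/seteqP; split. Qed.

Lemma C_Sl psi U n : C_ psi U n.+1 = U `&` psi @^-1` C_ psi U n.
Proof.
apply/seteqP; split=> [x xC|x [Ux xC] [|i]//= iltn].
  by split=> [|i /= iltn]; [exact: (xC 0%N)|rewrite -iterSr; exact: (xC i.+1)].
by rewrite -iterS iterSr; exact: xC.
Qed.

Lemma C_antitone psi U m n : (m <= n)%N -> C_ psi U n `<=` C_ psi U m.
Proof. by move=> mn x xC i /= im; exact: xC (leq_trans im mn). Qed.

Lemma C_sub psi U n : C_ psi U n.+1 `<=` U.
Proof. by move=> x /(_ 0%N); exact. Qed.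

(** Every i < n k is j + l k with j < k and l < n, so the k steps of psi that
define C_k fill the gaps left by sampling the orbit every k steps. *)
Lemma C_iter psi U k n : (0 < k)%N ->
  C_ (iter k psi) (C_ psi U k) n = C_ psi U (n * k).
Proof.
move=> k_gt0; have iterk i x : iter i (iter k psi) x = iter (i * k) psi x.
  by elim: i => //= i ->; rewrite -iterD.
apply/seteqP; split=> [x xC i /= ink|x xC i /= iltn j /= jltk].
  rewrite (divn_eq i k) addnC iterD -iterk; apply: xC; last exact: ltn_pmod.
  by rewrite /= ltn_divLR.
rewrite iterk -iterD; apply: xC => /=.
by rewrite (leq_trans (n := i.+1 * k))// ?leq_mul2r ?iltn ?orbT// mulSn ltn_add2r.
Qed.

Lemma C_iter_sup psi U k n : (0 < k)%N ->
  C_ psi U (n * k) `<=` C_ (iter k psi) U n.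
Proof.
move=> k_gt0; rewrite -C_iter// => x xC i iltn.
exact: xC i iltn 0%N k_gt0.
Qed.

Lemma iter_morphM psi k : {morph psi : x y / (x * y)%g} ->
  {morph iter k psi : x y / (x * y)%g}.
Proof. by move=> psiM x y; elim: k => //= k ->. Qed.

Lemma iter_continuous psi k : continuous psi -> continuous (iter k psi).
Proof.
move=> psic x; elim: k => [|k IHk]; first exact: cvg_id.
exact: (@continuous_comp _ _ _ (iter k psi) psi x IHk (psic _)).
Qed.

Section Endomorphism.
Variable psi : G -> G.
Hypothesis (psiM : {morph psi : x y / (x * y)%g}) (psic : continuous psi).
Variable U : set G.
Hypothesis UB : open_compact_subgroups U.

Let Ugrp : subgroup U. Proof. by case: UB. Qed.

Lemma C_subgroup n : subgroup (C_ psi U n).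
Proof.
elim: n => [|n IHn]; first by rewrite C_0; exact: subgroup_intro.
by rewrite C_Sl; exact: subgroupI Ugrp (subgroup_preimage psiM IHn).
Qed.

Lemma C_open n : open (C_ psi U n).
Proof.
have [_ oU _] := UB.
elim: n => [|n IHn]; first by rewrite C_0; exact: openT.
by rewrite C_Sl; apply: openI => //; apply: open_comp.
Qed.

Lemma C_open_compact_subgroups n : open_compact_subgroups (C_ psi U n.+1).
Proof.
have [_ _ cU] := UB; split; [exact: C_subgroup|exact: C_open|].
rewrite -(setIidr (@C_sub psi U n)); apply: compact_closedI => //.
exact: open_subgroup_closed (C_subgroup _) (C_open _).
Qed.

Lemma finite_left_cosets_C n : finite_set (left_cosets U (C_ psi U n)).
Proof.
have [_ _ cU] := UB.
exact: finite_left_cosets cU (C_subgroup _) (C_open _).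
Qed.

Lemma finite_left_cosets_CC m n :
  finite_set (left_cosets (C_ psi U m.+1) (C_ psi U n)).
Proof. exact: sub_finite_set (left_cosets_sub (@C_sub _ _ _)) (finite_left_cosets_C n). Qed.

Lemma subgroup_index_C_mul m n : (m < n)%N ->
  subgroup_index U (C_ psi U n) =
  (subgroup_index U (C_ psi U m.+1) * subgroup_index (C_ psi U m.+1) (C_ psi U n))%N.
Proof.
move=> mn; apply: subgroup_index_mul (finite_left_cosets_C n) => //;
  [exact: C_subgroup|exact: C_subgroup|exact: C_antitone|exact: C_sub].
Qed.

(** psi maps C_(n+2) into C_(n+1), and C_(n+3) is the part of C_(n+2) that psi
sends into C_(n+2). The shift by one is needed as C_0 is the whole group, in
which C_1 = U may have infinite index. *)
Lemma subgroup_index_C_step n :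
  (subgroup_index (C_ psi U n.+2) (C_ psi U n.+3)
    <= subgroup_index (C_ psi U n.+1) (C_ psi U n.+2))%N.
Proof.
have -> : C_ psi U n.+3 = C_ psi U n.+2 `&` psi @^-1` C_ psi U n.+2.
  apply/seteqP; split=> x => [xC|[/C_sub Ux xC]]; last by rewrite C_Sl.
  by split; [exact: C_antitone xC|move: xC; rewrite C_Sl => -[]].
apply: subgroup_index_preimage => //; do ?exact: C_subgroup.
- exact: C_antitone.
- by rewrite {1}C_Sl; exact: subIsetr.
- exact: subgroupI (C_subgroup _) (subgroup_preimage psiM (C_subgroup _)).
- apply: finite_left_cosets.
  + by have [] := C_open_compact_subgroups n.+1.
  + exact: subgroupI (C_subgroup _) (subgroup_preimage psiM (C_subgroup _)).
  + by apply: openI; [exact: C_open|apply: open_comp => //; exact: C_open].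
- exact: finite_left_cosets_CC.
Qed.

Lemma subgroup_index_C_gt0 n : (0 < subgroup_index U (C_ psi U n))%N.
Proof. exact: subgroup_index_gt0 (finite_left_cosets_C n). Qed.

Lemma subgroup_index_CC_gt0 m n :
  (0 < subgroup_index (C_ psi U m.+1) (C_ psi U n))%N.
Proof. exact: subgroup_index_gt0 (C_subgroup _) (finite_left_cosets_CC m n). Qed.

(** * Existence of the limit defining the entropy *)

Variable R : realType.
Local Open Scope ring_scope.

Let a n : R := ln (subgroup_index U (C_ psi U n))%:R.

Lemma ln_index_C_diff m n : (m < n)%N ->
  a n - a m.+1 = ln (subgroup_index (C_ psi U m.+1) (C_ psi U n))%:R.
Proof.
move=> mn; rewrite /a (subgroup_index_C_mul mn) natrM lnM ?posrE ?ltr0n.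
- by rewrite addrC addKr.
- exact: subgroup_index_C_gt0.
- exact: subgroup_index_CC_gt0.
Qed.

(** The telescoping sum of the increments is log [U : C_n], so Cesaro's theorem
transfers the limit of the increments to log [U : C_n] / n. *)
Lemma cvg_H_top : a n / n%:R @[n --> \oo] --> H_top R psi U.
Proof.
suff [l al] : exists l : R, (a n / n%:R @[n --> \oo] --> l).
  by apply/cvg_ex; exists l.
have /cvg_ex[l dl] : cvgn (fun n => telescope a n.+1).
  apply: nonincreasing_is_cvgn.
    apply/nonincreasing_seqP => n; rewrite /telescope /= !ln_index_C_diff//.
    rewrite ler_ln ?posrE ?ltr0n ?ler_nat ?subgroup_index_CC_gt0//.
    exact: subgroup_index_C_step.
  exists 0 => _ [n _ <-]; rewrite /telescope /= ln_index_C_diff// ln_ge0//.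
  by rewrite ler1n subgroup_index_CC_gt0.
exists l; rewrite -(@cvg_shiftS R); move: dl.
rewrite (@cvg_shiftS R) => /cesaro; apply: cvg_trans; apply: near_eq_cvg.
apply: nearW => n; rewrite /arithmetic_mean telescopeK /= {2}/a C_0.
by rewrite subgroup_indexT// ln1 subr0 mulrC.
Qed.

End Endomorphism.

(** * Entropy of the iterates *)

Section Powers.
Variable (R : realType) (psi : G -> G) (k : nat).
Hypothesis (psiM : {morph psi : x y / (x * y)%g}) (psic : continuous psi).
Hypothesis k_gt0 : (0 < k)%N.
Local Open Scope ring_scope.

Let kR_neq0 : k%:R != 0 :> R. Proof. by rewrite pnatr_eq0 -lt0n. Qed.

Lemma cvg_H_top_mul U : open_compact_subgroups U ->
  ln (subgroup_index U (C_ psi U (n * k)))%:R / n%:R @[n --> \oo]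
    --> k%:R * H_top R psi U.
Proof.
move=> UB.
have subseq : (n * k)%N @[n --> \oo] --> \oo.
  move=> A [N _ NA]; exists N => // n /= Nn; apply: NA => /=.
  by rewrite (leq_trans Nn)// leq_pmulr.
have kE n : ln (subgroup_index U (C_ psi U (n * k)))%:R / n%:R =
    k%:R * (ln (subgroup_index U (C_ psi U (n * k)))%:R / (n * k)%:R) :> R.
  by rewrite natrM invfM mulrCA; congr (_ * _); rewrite mulrCA divff// mulr1.
under eq_fun do rewrite kE.
apply: cvgMl_tmp.
exact: cvg_comp subseq (cvg_H_top psiM psic UB (R:=R)).
Qed.

(** log [C_k : C_(nk)] = log [U : C_(nk)] - log [U : C_k], where the last term
does not depend on n. *)
Lemma H_top_iter_C U : open_compact_subgroups U ->
  H_top R (iter k psi) (C_ psi U k) = k%:R * H_top R psi U.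
Proof.
move=> UB; apply: cvg_lim => //.
pose c : R := ln (subgroup_index U (C_ psi U k))%:R.
have c0 : c * n%:R^-1 @[n --> \oo] --> (0 : R).
  rewrite -(mulr0 c); apply: cvgMl_tmp; rewrite -(@cvg_shiftS R).
  exact: cvg_harmonic.
have -> : (fun n => ln (subgroup_index (C_ psi U k)
      (C_ (iter k psi) (C_ psi U k) n))%:R / n%:R) =
    (fun n => ln (subgroup_index U (C_ psi U (n * k)))%:R / n%:R - c / n%:R).
  (* For n = 0 the index identity may fail, but all three logarithms are
     divided by 0. *)
  apply: funext => -[|n]; first by rewrite !invr0 !mulr0 subr0.
  rewrite C_iter// -mulrBl; congr (_ / _).
  have [k' kE] : exists k', k = k'.+1 by exists k.-1; rewrite prednK.
  by rewrite /c kE ln_index_C_diff// mulSn leq_addr.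
by rewrite -[k%:R * _]subr0; exact: cvgB (cvg_H_top_mul UB) c0.
Qed.

Lemma H_top_iter_le U : open_compact_subgroups U ->
  H_top R (iter k psi) U <= k%:R * H_top R psi U.
Proof.
move=> UB; have [Ugrp _ _] := UB.
have psikM := iter_morphM k psiM; have psikc := iter_continuous (k:=k) psic.
apply: ler_cvg_to (cvg_H_top psikM psikc UB (R:=R)) (cvg_H_top_mul UB) _.
apply: nearW => -[|n]; first by rewrite !invr0 !mulr0.
rewrite ler_wpM2r// ler_ln ?posrE ?ltr0n ?ler_nat ?subgroup_index_C_gt0//.
apply: subgroup_index_antitone => //; try exact: C_subgroup.
- exact: C_iter_sup.
- exact: C_sub.
- exact: finite_left_cosets_C.
Qed.

(** The upper bound compares the entropies at one and the same U; for the lower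
bound, the value of psi^k at C_k(psi, U) matches that of psi at U. *)
Lemma h_top_iter : (h_top R (iter k psi) = k%:R%:E * h_top R psi)%E.
Proof.
have kR_gt0 : 0 < k%:R :> R by rewrite ltr0n.
apply/eqP; rewrite eq_le; apply/andP; split.
  apply: ge_ereal_sup => _ [U UB <-].
  apply: (@le_trans _ _ (k%:R * H_top R psi U)%:E).
    by rewrite lee_fin; exact: H_top_iter_le.
  by rewrite EFinM lee_pmul2l// ereal_sup_ubound//; exists U.
rewrite -ereal_sup_pZl//; apply: ge_ereal_sup => _ [_ [U UB <-] <-].
apply: ereal_sup_ubound; exists (C_ psi U k).
  by rewrite -(prednK k_gt0); exact: C_open_compact_subgroups.
by rewrite H_top_iter_C// EFinM.
Qed.

End Powers.
End Trajectories.

Theorem proposition4p5 (R : realType) (G : topologicalGroupType)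
    (G_lc : locally_compact [set: G])
    (G_td : totally_disconnected [set: G])
    (phi : G -> G) (phi_aut : topological_automorphism phi)
    (k : nat) (k_gt0 : (0 < k)%N) :
  h_top R (iter k phi) = k%:R%:E * h_top R phi.
Proof. by have [phiM [phic _]] := phi_aut; exact: h_top_iter. Qed.
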